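(* Let $\star$ be a finite-type star operation on a domain $R$ and $M$ a maximal $\star$-ideal of $R$. Then: (1) $M$ is $\star$-super potent if and only if $M$ is $\star$-potent and $MR_M$ is $d$-super potent (as a maximal ideal of $R_M$). (2) $R$ is $\star$-super potent if and only if $R$ is $\star$-potent and $R_P$ is $d$-super potent for each maximal $\star$-ideal $P$ of $R$.
   Context: For a domain $R$ with quotient field $K$, let $\mathcal F(R)$ be the set of nonzero fractional ideals of $R$. A star operation on $R$ is a map $\star:\mathcal F(R)\to\mathcal F(R)$, $A\mapsto A^\star$, such that for all $A,B\in\mathcal F(R)$ and $c\in K\setminus(0)$: $(cA)^\star=cA^\star$ and $R^\star=R$; $A\subseteq A^\star$, and $A\subseteq B$ implies $A^\star\subseteq B^\star$; $(A^\star)^\star=A^\star$. It has finite type if, for every $A\in\mathcal F(R)$, $A^\star=\bigcup J^\star$, the union over all nonzero finitely generated subideals $J$ of $A$. The $d$-operation is $I^d=I$ for all $I\in\mathcal F(R)$ (on any domain); it has finite type. For $I\in\mathcal F(R)$ put $I^{-1}=\{x\in K: xI\subseteq R\}$. Let $\star$ be a finite-type star operation on $R$. A $\star$-ideal is a nonzero ideal $I$ with $I^\star=I$. A maximal $\star$-ideal is an ideal of $R$ maximal among the proper $\star$-ideals (it is prime). A nonzero ideal $I$ is $\star$-invertible if $(II^{-1})^\star=R$. A nonzero finitely generated ideal $I$ of $R$ is $\star$-rigid if it is contained in exactly one maximal $\star$-ideal, and $\star$-super rigid if, in addition, every finitely generated ideal $J\supseteq I$ of $R$ is $\star$-invertible.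 A maximal $\star$-ideal is $\star$-potent (respectively $\star$-super potent) if it contains a $\star$-rigid (respectively $\star$-super rigid) ideal; $R$ is $\star$-potent (respectively $\star$-super potent) if each maximal $\star$-ideal of $R$ is $\star$-potent (respectively $\star$-super potent). *)

(* Defs.v *)
From mathcomp Require Export all_boot all_algebra.
From mathcomp Require Export boolp classical_sets.

Set Implicit Arguments.
Unset Strict Implicit.
Unset Printing Implicit Defensive.

Import GRing.Theory.
Local Open Scope classical_set_scope.
Local Open Scope ring_scope.

(* A domain is represented by its image D in a field K that is its quotient
   field; ideals and fractional ideals are then subsets of K.  This lets a
   domain and its localizations share the ambient field K. *)

Definition dom (R : idomainType) : set {fraction R} := range (@tofrac R).
Arguments dom : clear implicits.

Section Ideals.
Variables (K : fieldType) (D : set K).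
Implicit Types (A B I J M : set K) (c : K).

Definition submodule A : Prop :=
  [/\ A 0, forall x y, A x -> A y -> A (x + y)
    & forall r x, D r -> A x -> A (r * x)].

Definition nonzero A : Prop := exists2 x, A x & x != 0.

Definition fractional_ideal A : Prop :=
  [/\ submodule A, nonzero A
    & exists d, [/\ D d, d != 0 & forall x, A x -> D (d * x)]].

Definition is_ideal I : Prop := submodule I /\ I `<=` D.

Definition lin_span n (g : 'I_n -> K) : set K :=
  [set x | exists a : 'I_n -> K,
     (forall i, D (a i)) /\ x = \sum_(i < n) a i * g i].

Definition finitely_generated A : Prop :=
  exists n, exists g : 'I_n -> K, A = lin_span g.

Definition ideal_scale c A : set K := [set c * x | x in A].

Definition ideal_mul A B : set K :=
  [set x | exists n, exists a b : 'I_n -> K,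
     (forall i, A (a i) /\ B (b i)) /\ x = \sum_(i < n) a i * b i].

Definition ideal_inv I : set K := [set x | forall y, I y -> D (x * y)].

Definition localization M : set K :=
  [set x | exists a s, [/\ D a, D s, ~ M s & x = a / s]].

(* A star operation is a total function on sets; only its values on fractional
   ideals are constrained, and only these are ever used. *)
Record star_operation (star : set K -> set K) : Prop := StarOperation {
  star_fractional : forall A, fractional_ideal A -> fractional_ideal (star A);
  star_scale : forall c A, c != 0 -> fractional_ideal A ->
    star (ideal_scale c A) = ideal_scale c (star A);
  star_unit : star D = D;
  star_extensive : forall A, fractional_ideal A -> A `<=` star A;
  star_monotone : forall A B, fractional_ideal A -> fractional_ideal B ->
    A `<=` B -> star A `<=` star B;
  star_idempotent : forall A, fractional_ideal A -> star (star A) = star A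
}.

Definition finite_type (star : set K -> set K) : Prop :=
  forall A, fractional_ideal A ->
    star A = \bigcup_(J in [set J | [/\ finitely_generated J, nonzero J
                                      & J `<=` A]]) star J.

Variable star : set K -> set K.

Definition star_ideal I : Prop := [/\ is_ideal I, nonzero I & star I = I].

Definition maximal_star_ideal M : Prop :=
  [/\ star_ideal M, M <> D
    & forall J, star_ideal J -> J <> D -> M `<=` J -> J = M].

Definition star_invertible I : Prop := star (ideal_mul I (ideal_inv I)) = D.

Definition star_rigid I : Prop :=
  [/\ is_ideal I, nonzero I, finitely_generated I
    & exists! M, maximal_star_ideal M /\ I `<=` M].

Definition star_super_rigid I : Prop :=
  star_rigid I /\
  forall J, is_ideal J -> finitely_generated J -> I `<=` J -> star_invertible J.

Definition star_potent_ideal M : Prop :=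
  maximal_star_ideal M /\ exists I, star_rigid I /\ I `<=` M.

Definition star_super_potent_ideal M : Prop :=
  maximal_star_ideal M /\ exists I, star_super_rigid I /\ I `<=` M.

Definition star_potent : Prop :=
  forall M, maximal_star_ideal M -> star_potent_ideal M.

Definition star_super_potent : Prop :=
  forall M, maximal_star_ideal M -> star_super_potent_ideal M.

End Ideals.

Definition d_operation (K : fieldType) (A : set K) : set K := A.
Arguments d_operation : clear implicits.

(* Main.v *)
Require Import Defs.
From mathcomp Require Import ring.

(** The bridge between D and its localization D_M is a description of
    invertibility by maximal ideals.  Since the star operation has finite type,
    every proper star ideal lies in a maximal star ideal
    ([exists_maximal_star_ideal]); hence a nonzero ideal J is star-invertible
    exactly when J J^-1 lies in no maximal star ideal ([star_invertibleP]).
    Maximal star ideals M are prime, and when J is finitely generated J^-1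
    commutes with localization, so J J^-1 lies outside M if and only if J D_M
    is an invertible ideal of D_M ([trace_not_sub_primeP]).

    Suppose that I in M is star-super rigid.  Then I D_M is d-super rigid: D_M
    is local, and a finitely generated ideal B of D_M above I D_M is the
    extension of J = I + C for some finitely generated C in D.  As J contains
    I, it is star-invertible, hence B = J D_M is invertible.

    Conversely, let I in M be star-rigid and let A be a d-super rigid ideal of
    D_M.  Write A = C D_M with C finitely generated inside M, and put
    I' = I + C.  It is still star-rigid.  If J is finitely generated and
    contains I', then J D_M contains A, so it is invertible and J J^-1 is not
    inside M; but M is the only maximal star ideal that could contain J J^-1,
    because J J^-1 contains I.  So J is star-invertible and I' is star-super
    rigid.

    The second part follows from the first applied to every maximal star ideal,
    as M D_M is the only maximal ideal of D_M. *)

Set Implicit Arguments.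
Unset Strict Implicit.
Unset Printing Implicit Defensive.

Import GRing.Theory.
Local Open Scope classical_set_scope.
Local Open Scope ring_scope.

Definition subsemiring (K : fieldType) (D : set K) : Prop := submodule D D /\ D 1.

Definition ideal_add (K : fieldType) (A B : set K) : set K :=
  [set z | exists x y, [/\ A x, B y & z = x + y]].

Definition prime_ideal (K : fieldType) (D P : set K) : Prop :=
  [/\ is_ideal D P, ~ P 1
    & forall a b, D a -> D b -> P (a * b) -> P a \/ P b].

Definition ord_glue (T : Type) m n (u : 'I_m -> T) (v : 'I_n -> T)
    (i : 'I_(m + n)) : T :=
  match split i with inl j => u j | inr k => v k end.

Lemma ord_gluel (T : Type) m n (u : 'I_m -> T) (v : 'I_n -> T) j :
  ord_glue u v (lshift n j) = u j.
Proof. by rewrite /ord_glue (unsplitK (inl j : 'I_m + 'I_n)). Qed.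

Lemma ord_gluer (T : Type) m n (u : 'I_m -> T) (v : 'I_n -> T) k :
  ord_glue u v (rshift m k) = v k.
Proof. by rewrite /ord_glue (unsplitK (inr k : 'I_m + 'I_n)). Qed.

(** * Submodules, sums and products of ideals *)

Section Submodules.
Variables (K : fieldType) (D : set K).
Hypothesis ringD : subsemiring D.
Implicit Types (A B C I J : set K).

Lemma subsemiring0 : D 0. Proof. by case: ringD => -[]. Qed.

Lemma subsemiring1 : D 1. Proof. by case: ringD. Qed.

Lemma subsemiringD x y : D x -> D y -> D (x + y).
Proof. by case: ringD => -[_ addD _] _; apply: addD. Qed.

Lemma subsemiringM x y : D x -> D y -> D (x * y).
Proof. by case: ringD => -[_ _ mulD] _; apply: mulD. Qed.

Lemma unit_ideal : is_ideal D D.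
Proof. by case: ringD => modD _; split. Qed.

Lemma submodule_lincomb A n (a g : 'I_n -> K) : submodule D A ->
  (forall i, D (a i)) -> (forall i, A (g i)) -> A (\sum_(i < n) a i * g i).
Proof.
move=> [A0 addA mulA] Da Ag; elim/big_ind: _ => // i _; exact: mulA.
Qed.

Lemma ideal_eqD I : is_ideal D I -> I 1 -> I = D.
Proof.
move=> [[_ _ mulI] subI] I1; apply/seteqP; split=> // x Dx.
by rewrite -[x]mulr1; apply: mulI.
Qed.

Lemma ideal_fractional I : is_ideal D I -> nonzero I -> fractional_ideal D I.
Proof.
move=> [modI subI] nzI; split=> //; exists 1; split.
- exact: subsemiring1.
- exact: oner_neq0.
- by move=> x /subI; rewrite mul1r.
Qed.

Lemma nonzero_sub A B : A `<=` B -> nonzero A -> nonzero B.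
Proof. by move=> sub [x /sub Bx x0]; exists x. Qed.

Lemma lin_span_submodule n (g : 'I_n -> K) : submodule D (lin_span D g).
Proof.
split.
- exists (fun=> 0); split=> [_|]; first exact: subsemiring0.
  by rewrite big1 // => i _; rewrite mul0r.
- move=> _ _ [a [Da ->]] [b [Db ->]]; exists (fun i => a i + b i); split=> [i|].
    exact: subsemiringD.
  by rewrite -big_split; apply: eq_bigr => i _; rewrite mulrDl.
- move=> r _ Dr [a [Da ->]]; exists (fun i => r * a i); split=> [i|].
    exact: subsemiringM.
  by rewrite big_distrr; apply: eq_bigr => i _ /=; rewrite mulrA.
Qed.

Lemma lin_span_gen n (g : 'I_n -> K) i : lin_span D g (g i).
Proof.
exists (fun j => (j == i)%:R); split=> [j|].
  by case: (j == i); [exact: subsemiring1 | exact: subsemiring0].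
rewrite (bigD1 i) //= eqxx mul1r big1 ?addr0 // => j /negbTE->.
by rewrite mul0r.
Qed.

Lemma lin_span_min n (g : 'I_n -> K) A :
  submodule D A -> (forall i, A (g i)) -> lin_span D g `<=` A.
Proof. by move=> modA Ag _ [a [Da ->]]; apply: submodule_lincomb. Qed.

Lemma ideal_add_submodule A B :
  submodule D A -> submodule D B -> submodule D (ideal_add A B).
Proof.
move=> [A0 addA mulA] [B0 addB mulB]; split.
- by exists 0, 0; rewrite addr0.
- move=> _ _ [x [y [Ax By ->]]] [x' [y' [Ax' By' ->]]].
  by exists (x + x'), (y + y'); split; [exact: addA | exact: addB | ring].
- move=> r _ Dr [x [y [Ax By ->]]]; exists (r * x), (r * y).
  by split; [exact: mulA | exact: mulB | ring].
Qed.

Lemma ideal_addl A B : submodule D B -> A `<=` ideal_add A B.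
Proof. by move=> [B0 _ _] x Ax; exists x, 0; rewrite addr0. Qed.

Lemma ideal_addr A B : submodule D A -> B `<=` ideal_add A B.
Proof. by move=> [A0 _ _] x Bx; exists 0, x; rewrite add0r. Qed.

Lemma ideal_add_min A B C :
  submodule D C -> A `<=` C -> B `<=` C -> ideal_add A B `<=` C.
Proof.
by move=> [_ addC _] AC BC _ [x [y [/AC Cx /BC Cy ->]]]; apply: addC.
Qed.

Lemma ideal_add_ideal I J :
  is_ideal D I -> is_ideal D J -> is_ideal D (ideal_add I J).
Proof.
move=> [modI subI] [modJ subJ]; split; first exact: ideal_add_submodule.
by apply: ideal_add_min => //; case: unit_ideal.
Qed.

(** Concatenating two families of generators generates the sum. *)
Lemma ideal_add_fg A B : finitely_generated D A -> finitely_generated D B ->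
  finitely_generated D (ideal_add A B).
Proof.
move=> [m [g ->]] [n [h ->]].
have [modg modh] := (lin_span_submodule g, lin_span_submodule h).
exists (m + n)%N, (ord_glue g h); apply/seteqP; split.
  apply: ideal_add_min; first exact: lin_span_submodule.
  - apply: lin_span_min => [|j]; first exact: lin_span_submodule.
    by rewrite -(ord_gluel g h); apply: lin_span_gen.
  - apply: lin_span_min => [|k]; first exact: lin_span_submodule.
    by rewrite -(ord_gluer g h); apply: lin_span_gen.
apply: lin_span_min => [|i]; first exact: ideal_add_submodule.
case: (split_ordP i) => [j|k] ->; rewrite ?ord_gluel ?ord_gluer.
- by apply: (ideal_addl modh); apply: lin_span_gen.
- by apply: (ideal_addr modg); apply: lin_span_gen.
Qed.

Lemma ideal_mul_gen A B a b : A a -> B b -> ideal_mul A B (a * b).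
Proof.
move=> Aa Bb; exists 1%N, (fun=> a), (fun=> b); split=> //.
by rewrite big_ord1.
Qed.

Lemma ideal_mul_min A B C : submodule D C ->
  (forall a b, A a -> B b -> C (a * b)) -> ideal_mul A B `<=` C.
Proof.
move=> [C0 addC _] mulC _ [n [a [b [ABab ->]]]].
by elim/big_ind: _ => // i _; have [Aa Bb] := ABab i; apply: mulC.
Qed.

Lemma ideal_mul_submodule A B : submodule D A -> submodule D (ideal_mul A B).
Proof.
move=> [A0 addA mulA]; split.
- by exists 0%N, (fun=> 0), (fun=> 0); split=> [[]//|]; rewrite big_ord0.
- move=> _ _ [m [a [b [ABab ->]]]] [n [c [d [ABcd ->]]]].
  exists (m + n)%N, (ord_glue a c), (ord_glue b d); split.
    by move=> i; case: (split_ordP i) => [j|k] ->;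
      rewrite ?ord_gluel ?ord_gluer.
  by rewrite big_split_ord; congr (_ + _); apply: eq_bigr => i _;
    rewrite ?ord_gluel ?ord_gluer.
- move=> r _ Dr [n [a [b [ABab ->]]]]; exists n, (fun i => r * a i), b; split.
    by move=> i; have [Aa Bb] := ABab i; split=> //; apply: mulA.
  by rewrite big_distrr; apply: eq_bigr => i _ /=; rewrite mulrA.
Qed.

(** The ideal I I^-1, which measures how far I is from being invertible. *)
Definition trace_ideal I := ideal_mul I (ideal_inv D I).

Lemma trace_ideal_ideal I : is_ideal D I -> is_ideal D (trace_ideal I).
Proof.
move=> [modI _]; split; first exact: ideal_mul_submodule.
apply: ideal_mul_min => [|a b Ia invb]; first by case: unit_ideal.
by rewrite mulrC; apply: invb.
Qed.

(** For an ideal of D, the element 1 belongs to I^-1. *)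
Lemma sub_trace_ideal I : is_ideal D I -> I `<=` trace_ideal I.
Proof.
move=> [_ subI] x Ix; rewrite -[x]mulr1; apply: ideal_mul_gen => // y /subI.
by rewrite mul1r.
Qed.

End Submodules.

(** * Maximal star ideals *)

Section MaximalStarIdeals.
Variables (K : fieldType) (D : set K) (star : set K -> set K).
Hypotheses (ringD : subsemiring D) (star_op : star_operation D star).
Implicit Types (I J M N : set K).

Lemma star_sub_star_ideal I N : is_ideal D I -> nonzero I ->
  star_ideal D star N -> I `<=` N -> star I `<=` N.
Proof.
move=> idI nzI [idN nzN starN] IN; rewrite -starN.
by apply: (star_monotone star_op); first exact: ideal_fractional;
  first exact: ideal_fractional.
Qed.

Lemma star_closure I : is_ideal D I -> nonzero I -> star_ideal D star (star I).
Proof.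
move=> idI nzI; have fracI := ideal_fractional ringD idI nzI.
have [modI' nzI' _] := star_fractional star_op fracI.
split=> //; last exact: (star_idempotent star_op).
split=> //; apply: star_sub_star_ideal => //; last by case: idI.
split; [exact: unit_ideal | | exact: (star_unit star_op)].
by exists 1; [exact: subsemiring1 | exact: oner_neq0].
Qed.

Lemma maximal_star_ideal_not1 M : maximal_star_ideal D star M -> ~ M 1.
Proof. by move=> [[idM _ _] MD _] M1; apply: MD; apply: ideal_eqD. Qed.

(** If a b is in M and a is not, then N = M + a D is strictly larger than M, so
    its star closure is D.  Now b N is inside M, and scaling commutes with
    star, so b D = (b N)^star is inside M. *)
Lemma maximal_star_ideal_prime M :
  maximal_star_ideal D star M -> prime_ideal D M.
Proof.
move=> maxM; have M1 := maximal_star_ideal_not1 maxM.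
have [starM MD Mmax] := maxM; have [idM nzM _] := starM.
have [modM subM] := idM.
split=> // a b Da Db Mab; apply: contrapT => /not_orP [Ma Mb].
have b0 : b != 0 by apply/eqP => b0; apply: Mb; rewrite b0; case: modM.
have idaD : is_ideal D (ideal_scale a D).
  split=> [|_ [x Dx <-]]; last exact: subsemiringM.
  split; first by exists 0; [exact: subsemiring0 | rewrite mulr0].
  - move=> _ _ [x Dx <-] [y Dy <-]; exists (x + y); last by rewrite mulrDr.
    exact: subsemiringD.
  - move=> r _ Dr [x Dx <-]; exists (r * x); last by ring.
    exact: subsemiringM.
set N := ideal_add M (ideal_scale a D).
have MN : M `<=` N by have [modaD _] := idaD; apply: (ideal_addl modaD).
have Na : N a.
  apply: (ideal_addr modM); exists 1; [exact: subsemiring1 | exact: mulr1].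
have idN : is_ideal D N by apply: ideal_add_ideal.
have nzN := nonzero_sub MN nzM.
have fracN := ideal_fractional ringD idN nzN.
have starND : star N = D.
  apply: contrapT => starND; apply: Ma.
  rewrite -(Mmax (star N)) //; first exact: (star_extensive star_op).
  - exact: star_closure.
  - by move=> x /MN; apply: (star_extensive star_op).
have bNM : ideal_scale b N `<=` M.
  move=> _ [_ [m [_ [Mm [d Dd <-] ->]]] <-].
  have [_ addM mulM] := modM.
  rewrite (_ : _ * _ = b * m + d * (a * b)); last by ring.
  by apply: addM; apply: mulM.
apply: Mb; apply: (@star_sub_star_ideal (ideal_scale b N)) => //.
- split; last by move=> x /bNM /subM.
  have [[N0 addN mulN] _] := idN; split.
  + by exists 0; rewrite ?mulr0.
  + move=> _ _ [x Nx <-] [y Ny <-]; exists (x + y); last by rewrite mulrDr.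
    exact: addN.
  + move=> r _ Dr [x Nx <-]; exists (r * x); last by ring.
    exact: mulN.
- have [x Nx x0] := nzN; exists (b * x); last by rewrite mulf_neq0.
  by exists x.
- rewrite (star_scale star_op) // starND.
  exists 1; [exact: subsemiring1 | exact: mulr1].
Qed.

Hypothesis star_ft : finite_type D star.

(** This is where finite type enters: an element of the star closure of the
    union lies in J^star for a finitely generated J, whose generators all lie
    in one member of the chain. *)
Lemma star_ideal_directed_union (F : set (set K)) : F !=set0 ->
  total_on F subset -> (forall N, F N -> star_ideal D star N) ->
  star_ideal D star (\bigcup_(N in F) N).
Proof.
move=> [N0 FN0] totF starF; set U := \bigcup_(N in F) N.
have idU : is_ideal D U.
  split; last by move=> x [N /starF [[_ subN] _ _] /subN].
  split.
  - by exists N0 => //; have [[[]]] := starF _ FN0.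
  - move=> x y [N FN Nx] [N' FN' N'y].
    case: (totF _ _ FN FN') => sub.
    + exists N' => //; have [[[_ addN' _] _] _ _] := starF _ FN'.
      by apply: addN' => //; apply: sub.
    + exists N => //; have [[[_ addN _] _] _ _] := starF _ FN.
      by apply: addN => //; apply: sub.
  - move=> r x Dr [N FN Nx]; exists N => //.
    by have [[[_ _ mulN] _] _ _] := starF _ FN; apply: mulN.
have nzU : nonzero U.
  have [_ nzN0 _] := starF _ FN0; apply: nonzero_sub nzN0 => x N0x.
  by exists N0.
have fracU := ideal_fractional ringD idU nzU.
split=> //; apply/seteqP; split; last exact: (star_extensive star_op).
rewrite (star_ft fracU) => x [_ [[n [g ->]] nzJ JU] Jx].
(* Finitely many elements of the union of a chain lie in one member. *)
have inF m (h : 'I_m -> K) : (forall i, U (h i)) ->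
    exists2 N, F N & forall i, N (h i).
  elim: m h => [|m IHm] h Uh; first by exists N0 => // -[].
  have [N FN Nh] := IHm _ (fun i => Uh (lift ord0 i)).
  have [N' FN' N'h] := Uh ord0.
  case: (totF _ _ FN FN') => sub.
  + exists N' => // i; case: (unliftP ord0 i) => [j|] -> //; exact: sub.
  + exists N => // i; case: (unliftP ord0 i) => [j|] -> //; exact: sub.
have [i|N FN Ng] := inF _ g; first by apply: JU; apply: lin_span_gen.
exists N => //; have starN := starF _ FN; have [[modN subN] _ _] := starN.
have JN : lin_span D g `<=` N by apply: lin_span_min.
apply: (star_sub_star_ideal _ nzJ starN JN) => //.
by split; [exact: lin_span_submodule | move=> y /JN /subN].
Qed.

(** Zorn's lemma, with the closed ideal I^star built into the predicate: the
    sets X such that the union of I^star and X is a proper star ideal.  In this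
    form the empty chain has the empty set as an upper bound. *)
Lemma exists_maximal_star_ideal I : is_ideal D I -> nonzero I ->
  star I <> D -> exists2 M, maximal_star_ideal D star M & I `<=` M.
Proof.
move=> idI nzI properI; pose I' := star I.
have starI' : star_ideal D star I' by apply: star_closure.
pose P X := star_ideal D star (I' `|` X) /\ ~ (I' `|` X) 1.
have [F FP totF|X [[starM M1] Xmax]] := @Zorn_bigcup _ P.
  have [->|/set0P F0] := eqVneq F set0.
    rewrite bigcup_set0 /P setU0; split=> // I'1; apply: properI.
    by apply: ideal_eqD => //; case: starI'.
  have UE : I' `|` \bigcup_(X in F) X =
      \bigcup_(N in [set I' `|` X | X in F]) N.
    rewrite bigcup_image; apply/seteqP; split=> x.
    + have [X0 FX0] := F0.
      by case=> [I'x|[X FX Xx]]; [exists X0 => //; left | exists X => //; right].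
    + by case=> X FX [I'x|Xx]; [left | right; exists X].
  rewrite /P UE; split; last by move=> [_ [X /FP [_ X1] <-]].
  apply: star_ideal_directed_union.
  - by have [X0 FX0] := F0; exists (I' `|` X0), X0.
  - move=> _ _ [X FX <-] [Y FY <-].
    by case: (totF _ _ FX FY) => sub; [left|right]; apply: setUS.
  - by move=> _ [X /FP [] ? _ <-].
exists (I' `|` X); last first.
  move=> x Ix; left; apply: (star_extensive star_op) => //.
  exact: ideal_fractional.
split=> // [MD|J starJ JD MJ]; first by apply: M1; rewrite MD; apply: subsemiring1.
apply/seteqP; split=> // x Jx; right; apply: contrapT => Xx.
have I'J : I' `<=` J by move=> y I'y; apply: MJ; left.
apply: (Xmax J); first by split=> [y Xy|XJ]; [apply: MJ; right | apply/Xx/XJ].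
rewrite /P (setUidPr _ _).2 //; split=> // J1; apply: JD; apply: ideal_eqD => //.
by case: starJ.
Qed.

Lemma star_eq_unitP I : is_ideal D I -> nonzero I ->
  star I = D <-> forall M, maximal_star_ideal D star M -> ~ I `<=` M.
Proof.
move=> idI nzI; split=> [starID M maxM IM|noM].
  apply: (maximal_star_ideal_not1 maxM).
  have [starM _ _] := maxM; apply: (star_sub_star_ideal idI nzI starM IM).
  by rewrite starID; apply: subsemiring1.
apply: contrapT => /(exists_maximal_star_ideal idI nzI) [M maxM IM].
exact: noM maxM IM.
Qed.

Lemma star_invertibleP I : is_ideal D I -> nonzero I ->
  star_invertible D star I <->
  forall M, maximal_star_ideal D star M -> ~ trace_ideal D I `<=` M.
Proof.
move=> idI nzI; apply: star_eq_unitP; first exact: trace_ideal_ideal.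
apply: nonzero_sub nzI; exact: sub_trace_ideal.
Qed.

End MaximalStarIdeals.

(** Enlarging a rigid ideal can only lose maximal star ideals above it, and the
    bound J in M keeps M. *)
Lemma star_rigid_sub (K : fieldType) (D : set K) (star : set K -> set K)
    (I J M : set K) :
  star_rigid D star I -> is_ideal D J -> finitely_generated D J ->
  maximal_star_ideal D star M -> I `<=` J -> J `<=` M -> star_rigid D star J.
Proof.
move=> [_ nzI _ [N [_ uniqN]]] idJ fgJ maxM IJ JM.
split=> //; first exact: nonzero_sub nzI.
exists M; split=> // N' [maxN' JN'].
by apply: etrans (esym (uniqN M _)) (uniqN N' _); split=> //;
  apply: (subset_trans IJ).
Qed.

(** * Localization at a prime ideal *)

Section Localization.
Variables (K : fieldType) (D P : set K).
Hypotheses (ringD : subsemiring D) (primeP : prime_ideal D P).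
Implicit Types (A B C I J N : set K).

Local Notation L := (localization D P).
Local Notation extension A := (ideal_mul A L).

Lemma prime_compl_neq0 s : ~ P s -> s != 0.
Proof.
have [[[P0 _ _] _] _ _] := primeP.
by move=> Ps; apply/eqP => s0; apply: Ps; rewrite s0.
Qed.

Lemma prime_complM s t : D s -> D t -> ~ P s -> ~ P t -> ~ P (s * t).
Proof. by have [_ _ prP] := primeP; move=> Ds Dt Ps Pt /prP []. Qed.

Lemma localization_inv s : D s -> ~ P s -> L s^-1.
Proof.
by move=> Ds Ps; exists 1, s; rewrite mul1r; split=> //; apply: subsemiring1.
Qed.

Lemma sub_localization : D `<=` L.
Proof.
have [_ P1 _] := primeP; move=> x Dx; exists x, 1; rewrite divr1.
by split=> //; apply: subsemiring1.
Qed.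

Lemma localization_subsemiring : subsemiring L.
Proof.
split; last by apply: sub_localization; apply: subsemiring1.
split.
- by apply: sub_localization; apply: subsemiring0.
- move=> _ _ [a [s [Da Ds Ps ->]]] [b [t [Db Dt Pt ->]]].
  have [s0 t0] := (prime_compl_neq0 Ps, prime_compl_neq0 Pt).
  exists (a * t + b * s), (s * t); split.
  + by apply: subsemiringD => //; apply: subsemiringM.
  + exact: subsemiringM.
  + exact: prime_complM.
  + by field; rewrite s0 t0.
- move=> _ _ [a [s [Da Ds Ps ->]]] [b [t [Db Dt Pt ->]]].
  have [s0 t0] := (prime_compl_neq0 Ps, prime_compl_neq0 Pt).
  exists (a * b), (s * t); split; [exact: subsemiringM | exact: subsemiringM | |].
  + exact: prime_complM.
  + by field; rewrite s0 t0.
Qed.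
Let ringL := localization_subsemiring.

Lemma submodule_localization A : submodule L A -> submodule D A.
Proof.
by move=> [A0 addA mulA]; split=> // r x /sub_localization; apply: mulA.
Qed.

Lemma extension_submodule A : submodule L (extension A).
Proof.
rewrite (_ : extension A = ideal_mul L A).
  exact/ideal_mul_submodule/ringL.1.
by apply/seteqP; split=> _ [n [a [b [ABab ->]]]]; exists n, b, a;
  (split=> [i|]; [case: (ABab i) | apply: eq_bigr => i _; exact: mulrC]).
Qed.

Lemma sub_extension A : A `<=` extension A.
Proof.
move=> x Ax; rewrite -[x]mulr1; apply: ideal_mul_gen => //; exact: subsemiring1.
Qed.

Lemma extension_min A C : submodule L C -> A `<=` C -> extension A `<=` C.
Proof.
move=> modC AC; apply: (ideal_mul_min modC) => a b /AC Ca Lb.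
by rewrite mulrC; case: modC => _ _; apply.
Qed.

Lemma extension_mono A B : A `<=` B -> extension A `<=` extension B.
Proof.
move=> AB; apply: extension_min; first exact: extension_submodule.
exact: subset_trans AB (@sub_extension B).
Qed.

(** Fractions a / s with a in A already form a module over the localization,
    so sums of products collapse to a single fraction. *)
Lemma mem_extension A x : submodule D A ->
  extension A x <-> exists a s, [/\ A a, D s, ~ P s & x = a / s].
Proof.
move=> [A0 addA mulA]; split; last first.
  move=> [a [s [Aa Ds Ps ->]]]; apply: ideal_mul_gen => //.
  exact: localization_inv.
pose C := [set x | exists a s, [/\ A a, D s, ~ P s & x = a / s]].
have [_ P1 _] := primeP.
have modC : submodule L C.
  split.
  - by exists 0, 1; rewrite mul0r; split=> //; apply: subsemiring1.
  - move=> _ _ [a [s [Aa Ds Ps ->]]] [b [t [Ab Dt Pt ->]]].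
    have [s0 t0] := (prime_compl_neq0 Ps, prime_compl_neq0 Pt).
    exists (t * a + s * b), (s * t); split.
    + by apply: addA; apply: mulA.
    + exact: subsemiringM.
    + exact: prime_complM.
    + by field; rewrite s0 t0.
  - move=> _ _ [r [s [Dr Ds Ps ->]]] [a [t [Aa Dt Pt ->]]].
    have [s0 t0] := (prime_compl_neq0 Ps, prime_compl_neq0 Pt).
    exists (r * a), (s * t); split; [exact: mulA | exact: subsemiringM | |].
    + exact: prime_complM.
    + by field; rewrite s0 t0.
apply: (@extension_min A C modC) => a Aa.
by exists a, 1; rewrite divr1; split=> //; apply: subsemiring1.
Qed.

Lemma extension_ideal I : is_ideal D I -> is_ideal L (extension I).
Proof.
move=> [_ subI]; split; first exact: extension_submodule.
apply: extension_min; first exact: ringL.1.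
exact: subset_trans subI sub_localization.
Qed.

Lemma extension_lin_span n (g : 'I_n -> K) :
  extension (lin_span D g) = lin_span L g.
Proof.
have modLg := lin_span_submodule ringL g.
apply/seteqP; split.
  apply: extension_min => //; apply: lin_span_min => [|i].
    exact: submodule_localization.
  exact: lin_span_gen.
apply: lin_span_min => [|i]; first exact: extension_submodule.
by apply: sub_extension; apply: lin_span_gen.
Qed.

Lemma extension_fg A : finitely_generated D A ->
  finitely_generated L (extension A).
Proof. by move=> [n [g ->]]; exists n, g; apply: extension_lin_span. Qed.

(** Denominators are units of the localization, so each generator may be
    replaced by its numerator. *)
Lemma localization_fg_descent A B : submodule D A -> finitely_generated L B ->
  B `<=` extension A -> exists C, [/\ submodule D C, finitely_generated D C,
    C `<=` A & B = extension C].
Proof.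
move=> modA [n [b ->]] BA.
have /choice [a] : forall i, exists a, exists s,
    [/\ A a, D s, ~ P s & b i = a / s].
  by move=> i; apply/mem_extension => //; apply/BA/lin_span_gen.
move=> /choice [s asP]; exists (lin_span D a); split.
- exact: lin_span_submodule.
- by exists n, a.
- by apply: lin_span_min => // i; case: (asP i).
rewrite extension_lin_span; apply/seteqP; split.
  apply: lin_span_min => [|i]; first exact: lin_span_submodule.
  have [Aa Ds Ps ->] := asP i; rewrite mulrC.
  have [_ _ mulLa] := lin_span_submodule ringL a.
  by apply: mulLa; [exact: localization_inv | exact: lin_span_gen].
apply: lin_span_min => [|i]; first exact: lin_span_submodule.
have [Aa Ds Ps bE] := asP i; have s0 := prime_compl_neq0 Ps.
have [_ _ mulLb] := lin_span_submodule ringL b.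
rewrite (_ : a i = s i * b i); last by rewrite bE mulrC divfK.
by apply: mulLb; [exact: sub_localization | exact: lin_span_gen].
Qed.

Lemma extension_prime_not1 : ~ extension P 1.
Proof.
have [[modP _] P1 _] := primeP.
move=> /(mem_extension _ modP) [a [s [Pa _ Ps E]]].
suff sa : s = a by apply: Ps; rewrite sa.
by rewrite -[s]mul1r E divfK //; apply: prime_compl_neq0.
Qed.

(** A fraction a / s with a outside P is a unit. *)
Lemma proper_sub_extension_prime N : is_ideal L N -> ~ N 1 ->
  N `<=` extension P.
Proof.
move=> [[_ _ mulN] subN] N1 x Nx.
have [a [s [Da Ds Ps xE]]] := subN x Nx.
have [[modP _] _ _] := primeP.
apply/mem_extension => //; exists a, s; split=> //.
apply: contrapT => Pa; apply: N1.
have [s0 a0] := (prime_compl_neq0 Ps, prime_compl_neq0 Pa).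
rewrite (_ : 1 = a^-1 * (s * x)); last by rewrite xE; field; rewrite s0 a0.
apply: (mulN); first exact: localization_inv.
by apply: mulN => //; apply: sub_localization.
Qed.

Lemma maximal_ideal_localizationP N : nonzero P ->
  maximal_star_ideal L (d_operation K) N <-> N = extension P.
Proof.
move=> nzP; have [idP P1 _] := primeP.
have idPL := extension_ideal idP.
have starPL : star_ideal L (d_operation K) (extension P).
  by split=> //; apply: nonzero_sub nzP; apply: sub_extension.
split=> [[[idN nzN _] NL Nmax]|->].
  have NP : N `<=` extension P.
    by apply: proper_sub_extension_prime => // N1; apply: NL; apply: ideal_eqD.
  rewrite (Nmax (extension P)) // => PL; apply: extension_prime_not1.
  by rewrite PL; apply: subsemiring1.
split=> // [PL|J [idJ _ _] JL PJ].
  by apply: extension_prime_not1; rewrite PL; apply: subsemiring1.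
apply/seteqP; split=> //; apply: proper_sub_extension_prime => // J1.
by apply: JL; apply: ideal_eqD.
Qed.

Lemma common_denominator n (x : 'I_n -> K) : (forall i, L (x i)) ->
  exists s, [/\ D s, ~ P s & forall i, D (s * x i)].
Proof.
have [_ P1 _] := primeP.
elim: n x => [|n IHn] x Lx.
  by exists 1; split=> // [|[]//]; apply: subsemiring1.
have [s [Ds Ps sx]] := IHn _ (fun i => Lx (lift ord0 i)).
have [a [t [Da Dt Pt x0E]]] := Lx ord0; have t0 := prime_compl_neq0 Pt.
exists (s * t); split; [exact: subsemiringM | exact: prime_complM |] => i.
case: (unliftP ord0 i) => [j|] ->.
  by rewrite mulrAC mulrC; apply: subsemiringM.
rewrite x0E (_ : s * t * (a / t) = s * a); last by field.
exact: subsemiringM.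
Qed.

(** Localization commutes with the inverse of a finitely generated ideal: a
    common denominator for the products of y with the generators works for the
    whole ideal. *)
Lemma ideal_inv_extension J y : finitely_generated D J ->
  ideal_inv L (extension J) y ->
  exists s, [/\ D s, ~ P s & ideal_inv D J (s * y)].
Proof.
move=> [n [g ->]] invy.
have Lyg i : L (y * g i).
  by apply/invy/sub_extension; apply: lin_span_gen.
have [s [Ds Ps syg]] := common_denominator Lyg.
exists s; split=> // _ [a [Da ->]].
rewrite big_distrr; elim/big_ind: _ => [||i _ /=].
- exact: subsemiring0.
- exact: subsemiringD.
- rewrite (_ : s * y * _ = a i * (s * (y * g i))); last by ring.
  exact: subsemiringM.
Qed.

(** An element of J J^-1 outside P is a unit of the localization and lies in
    the trace of the extended ideal.  Conversely, if J J^-1 is inside P, then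
    clearing denominators puts each product x y, with x in the extension of J
    and y in its inverse, into the extension of P, so 1 is not a sum of such
    products. *)
Lemma trace_not_sub_primeP J : is_ideal D J -> finitely_generated D J ->
  ~ trace_ideal D J `<=` P <->
  star_invertible L (d_operation K) (extension J).
Proof.
move=> idJ fgJ; have [modJ subJ] := idJ; have idJL := extension_ideal idJ.
have [idP _ _] := primeP; have [modP _] := idP.
have idT := trace_ideal_ideal ringD idJ.
have [modTL _] := trace_ideal_ideal ringL idJL.
split=> [nTP|JL TP].
  change (trace_ideal L (extension J) = L).
  apply: ideal_eqD; first exact: trace_ideal_ideal.
  have [z Tz Pz] : exists2 z, trace_ideal D J z & ~ P z.
    by apply: contrapT => noz; apply: nTP => z Tz; apply: contrapT => Pz;
      apply: noz; exists z.
  have Dz : D z by case: idT => _; apply.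
  rewrite -(mulVf (prime_compl_neq0 Pz)); case: (modTL) => _ _ mulT.
  apply: mulT; first exact: localization_inv.
  apply: ideal_mul_min Tz; first exact: submodule_localization.
  move=> a b Ja invb; apply: ideal_mul_gen; first exact: sub_extension.
  move=> y /(mem_extension _ modJ) [j [s [Jj Ds Ps ->]]].
  by exists (b * j), s; split=> //; [apply: invb | rewrite mulrA].
apply: extension_prime_not1.
have : trace_ideal L (extension J) 1.
  by rewrite /trace_ideal (JL : ideal_mul _ _ = L); apply: subsemiring1.
apply: ideal_mul_min; first exact: extension_submodule.
move=> x y /(mem_extension _ modJ) [j [s [Jj Ds Ps ->]]].
move=> /(ideal_inv_extension fgJ) [t [Dt Pt invty]].
have [s0 t0] := (prime_compl_neq0 Ps, prime_compl_neq0 Pt).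
apply/mem_extension => //; exists (j * (t * y)), (s * t); split.
- by apply: TP; apply: ideal_mul_gen.
- exact: subsemiringM.
- exact: prime_complM.
- by field; rewrite s0 t0.
Qed.

End Localization.

(** * Super potency and localization *)

Section SuperPotent.
Variables (K : fieldType) (D : set K) (star : set K -> set K).
Hypotheses (ringD : subsemiring D) (star_op : star_operation D star).
Hypothesis star_ft : finite_type D star.
Variable M : set K.
Hypothesis maxM : maximal_star_ideal D star M.

Local Notation L := (localization D M).
Local Notation extension A := (ideal_mul A L).

Let primeM := maximal_star_ideal_prime ringD star_op maxM.
Let ringL := localization_subsemiring ringD primeM.
Let nzM : nonzero M. Proof. by have [[]] := maxM. Qed.

(** A finitely generated ideal of D_M above I D_M is extended from a finitely
    generated ideal of D above I: add I to any finitely generated ideal of D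
    that extends to it. *)
Lemma super_potent_localization : star_super_potent_ideal D star M ->
  star_super_potent_ideal L (d_operation K) (extension M).
Proof.
move=> [_ [I [[[idI nzI fgI _] superI] IM]]].
have maxML N := maximal_ideal_localizationP ringD primeM N nzM.
split; first exact/maxML.
have IML := extension_mono ringD primeM IM.
exists (extension I); split=> //; split.
  split; first exact: extension_ideal.
  - by apply: nonzero_sub nzI; apply: sub_extension.
  - exact: extension_fg.
  - exists (extension M); split=> [|N [/maxML -> _]] //; split=> //.
    exact/maxML.
move=> B idB fgB IB; have [modB subB] := idB; have modD := unit_ideal ringD.
have [|C [modC fgC CD BE]] :=
    localization_fg_descent ringD primeM modD.1 fgB.
  by apply: (subset_trans subB) => x [a [s [Da Ds Ms ->]]];
    apply/mem_extension => //; [exact: modD.1 | exists a, s].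
pose J := ideal_add I C.
have idJ : is_ideal D J by apply: ideal_add_ideal.
have fgJ : finitely_generated D J by apply: ideal_add_fg.
have IJ : I `<=` J := ideal_addl modC.
have JE : extension J = B.
  apply/seteqP; split; last first.
    by rewrite BE; apply: extension_mono => //; apply: ideal_addr idI.1.
  apply: extension_min => //; apply: ideal_add_min.
  - exact: submodule_localization modB.
  - by move=> x Ix; apply: IB; apply: sub_extension Ix.
  - by rewrite BE; apply: sub_extension.
rewrite -JE; apply/trace_not_sub_primeP => //.
apply: (star_invertibleP ringD star_op star_ft idJ _).1 => //.
- exact: nonzero_sub nzI.
- exact: superI.
Qed.

(** The witness is I + C, where I is rigid and C D_M is super rigid: I singles
    out M among the maximal star ideals, and C controls what happens at M. *)
Lemma super_potent_of_localization : star_potent_ideal D star M ->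
  star_super_potent_ideal L (d_operation K) (extension M) ->
  star_super_potent_ideal D star M.
Proof.
move=> [_ [I [rigidI IM]]] [_ [A [[[idA nzA fgA _] superA] AM]]].
split=> //; have [idM _ _] := primeM; have [idI nzI fgI _] := rigidI.
have [C [modC fgC CM AE]] := localization_fg_descent ringD primeM idM.1 fgA AM.
have idC : is_ideal D C by split=> //; apply: subset_trans CM idM.2.
pose I' := ideal_add I C.
have I'M : I' `<=` M := ideal_add_min idM.1 IM CM.
have II' : I `<=` I' := ideal_addl modC.
exists I'; split=> //; split.
  apply: star_rigid_sub rigidI _ _ maxM II' I'M.
  - exact: ideal_add_ideal.
  - exact: ideal_add_fg.
move=> J idJ fgJ I'J; have IJ := subset_trans II' I'J.
apply/star_invertibleP => //; first exact: nonzero_sub nzI.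
(* Since J J^-1 contains the rigid ideal I, only M could contain it. *)
move=> N maxN TN.
have NM : N = M.
  have [_ _ _ [N0 [_ uniqN]]] := rigidI.
  apply: etrans (esym (uniqN N _)) (uniqN M _); split=> //.
  by apply: (subset_trans IJ); apply: subset_trans TN; apply: sub_trace_ideal.
move: TN; rewrite NM; apply/trace_not_sub_primeP => //; apply: superA.
- exact: extension_ideal.
- exact: extension_fg.
- rewrite AE; apply: extension_mono => //.
  exact: subset_trans (ideal_addr idI.1) I'J.
Qed.

Lemma star_super_potent_idealP : star_super_potent_ideal D star M <->
  star_potent_ideal D star M /\
  star_super_potent_ideal L (d_operation K) (extension M).
Proof.
split=> [superM|[]]; last exact: super_potent_of_localization.
split; last exact: super_potent_localization.
by case: superM => _ [I [[rigidI _] IM]]; split=> //; exists I.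
Qed.

(** A local ring has only one maximal ideal to test. *)
Lemma local_super_potentP : star_super_potent L (d_operation K) <->
  star_super_potent_ideal L (d_operation K) (extension M).
Proof.
have maxML N := maximal_ideal_localizationP ringD primeM N nzM.
split=> [|superM N /maxML -> //]; apply; exact/maxML.
Qed.

End SuperPotent.

Lemma dom_subsemiring (R : idomainType) : subsemiring (dom R).
Proof.
split; last by exists 1; rewrite ?tofrac1.
split.
- by exists 0; rewrite ?tofrac0.
- by move=> _ _ [a _ <-] [b _ <-]; exists (a + b); rewrite ?tofracD.
- by move=> _ _ [a _ <-] [b _ <-]; exists (a * b); rewrite ?tofracM.
Qed.

Theorem theorem1p10 (R : idomainType)
    (star : set {fraction R} -> set {fraction R})
    (star_op : star_operation (dom R) star)
    (star_ft : finite_type (dom R) star)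
    (M : set {fraction R}) (maxM : maximal_star_ideal (dom R) star M) :
  (star_super_potent_ideal (dom R) star M <->
     star_potent_ideal (dom R) star M /\
     star_super_potent_ideal (localization (dom R) M)
       (d_operation {fraction R}) (ideal_mul M (localization (dom R) M)))
  /\
  (star_super_potent (dom R) star <->
     star_potent (dom R) star /\
     forall P : set {fraction R}, maximal_star_ideal (dom R) star P ->
       star_super_potent (localization (dom R) P) (d_operation {fraction R})).
Proof.
have ringD := dom_subsemiring R.
have superP := star_super_potent_idealP ringD star_op star_ft.
have localP := local_super_potentP ringD star_op.
split; first exact: superP.
split=> [superR|[potentR localR] P maxP].
  split=> P maxP; first exact: ((superP P maxP).1 (superR P maxP)).1.
  exact/(localP P maxP)/((superP P maxP).1 (superR P maxP)).2.
apply/superP => //; split; first exact: potentR.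
exact/(localP P maxP)/localR.
Qed.
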